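(* Let $q>1$, let $(V,E,\mu)$ be a weighted graph as in the context (this is the case of vertex weight $\sigma\equiv1$ and edge length $\rho\equiv1$), let $o\in V$, and let $B(o,r)$ denote the closed graph-distance ball of radius $r$ about $o$. Then $$\int_1^\infty\frac{r}{\mu(B(o,r))^{q-1}}\,dr=\infty\quad\Longleftrightarrow\quad\sum_{n=1}^\infty\frac{n}{\mu(B(o,n))^{q-1}}=\infty .$$ If $\sum_{n=1}^\infty n\,\mu(B(o,n))^{1-q}=\infty$, then every nonnegative global classical supersolution of $\partial_tu-\Delta u\ge u^q$ on $(0,\infty)\times V$ vanishes identically.
   Context: Let $(V,E)$ be an infinite, connected, locally finite graph with at most one edge between two distinct vertices and no loops. Let $\mu:V\times V\to[0,\infty)$ be symmetric with $\mu_{xy}>0$ if $x\sim y$ and $\mu_{xy}=0$ otherwise; put $\mu(x)=\sum_{y\sim x}\mu_{xy}$ and $\mu(A)=\sum_{x\in A}\mu(x)$. The normalized graph Laplacian is $$\Delta f(x)=\frac1{\mu(x)}\sum_{y\sim x}\mu_{xy}(f(y)-f(x)).$$ The graph distance is the minimal number of edges of a path joining two vertices, and $B(o,r)=\{x\in V: d(o,x)\le r\}$ for this distance $d$. A nonnegative global classical supersolution of $\partial_tu-\Delta u\ge u^q$ on $(0,\infty)\times V$ is a function $u:(0,\infty)\times V\to[0,\infty)$ with $u(\cdot,x)\in C^1((0,\infty))$ for every $x\in V$ satisfying the inequality pointwise; no value or trace at $t=0$ is assumed. *)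

(* Defs.v *)
From HB Require Import structures.
From mathcomp Require Import all_boot all_order all_algebra.
From mathcomp Require Import all_classical all_reals all_analysis.
Set Implicit Arguments.
Unset Strict Implicit.
Unset Printing Implicit Defensive.
Import Order.TTheory GRing.Theory Num.Theory.
Import numFieldNormedType.Exports.
Local Open Scope classical_set_scope.
Local Open Scope ring_scope.

Record weighted_graph (R : realType) := WeightedGraph {
  vertex :> choiceType;
  adj : rel vertex;
  weight : vertex -> vertex -> R;
  adj_sym : symmetric adj;
  adj_irr : irreflexive adj;
  vertex_infinite : infinite_set [set: vertex];
  adj_locally_finite : forall x, finite_set [set y | adj x y];
  adj_connected : forall x y, exists p, path adj x p /\ last x p = y;
  weight_ge0 : forall x y, 0 <= weight x y;
  weight_sym : forall x y, weight x y = weight y x;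
  weight_gt0 : forall x y, adj x y -> 0 < weight x y;
  weight_eq0 : forall x y, ~~ adj x y -> weight x y = 0
}.

Section weighted_graph_theory.
Context {R : realType} (G : weighted_graph R).

(* A path from [x] is [x :: p] with [path adj x p]; it has [size p] edges. *)
Definition joined_by (x y : G) (n : nat) : bool :=
  `[< exists p : seq G, [/\ path (@adj R G) x p, last x p = y & size p = n] >].

Lemma ex_joined_by (x y : G) : exists n, joined_by x y n.
Proof.
by have [p [xp py]] := adj_connected x y; exists (size p); apply/asboolP; exists p.
Qed.

Definition graph_dist (x y : G) : nat := ex_minn (ex_joined_by x y).

Definition graph_ball (o : G) (r : R) : set G :=
  [set x | (graph_dist o x)%:R <= r].

Definition vertex_measure (x : G) : R :=
  \sum_(y \in [set y | adj x y]) weight x y.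

(* The sum over a set of vertices is only meaningful for a finite set (it is 0
   otherwise); balls are finite because the graph is locally finite. *)
Definition set_measure (A : set G) : R := \sum_(x \in A) vertex_measure x.

Definition laplacian (f : G -> R) (x : G) : R :=
  (vertex_measure x)^-1 *
  \sum_(y \in [set y | adj x y]) (weight x y * (f y - f x)).

(* Only the values of [u] at positive times matter: every condition is imposed
   at [t > 0] and derivatives are local. *)
Definition nonneg_supersolution (q : R) (u : R -> G -> R) : Prop :=
  [/\ forall t x, 0 < t -> 0 <= u t x,
      forall t x, 0 < t -> derivable (u^~ x) t 1,
      forall t x, 0 < t -> {for t, continuous (derive1 (u^~ x))} &
      forall t x, 0 < t ->
        derive1 (u^~ x) t - laplacian (u t) x >= u t x `^ q].

End weighted_graph_theory.

(* Main.v *)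
Require Import Defs.
From mathcomp Require Import all_boot all_order all_algebra.
From mathcomp Require Import all_classical all_reals all_analysis.
From mathcomp Require Import measurable_realfun.
From mathcomp Require Import ring lra zify.
Set Implicit Arguments.
Unset Strict Implicit.
Unset Printing Implicit Defensive.
Import Order.TTheory GRing.Theory Num.Theory.
Import numFieldNormedType.Exports.
Local Open Scope classical_set_scope.
Local Open Scope ring_scope.

(** The two conditions agree because the ball of radius [r] does not change
    while [r] runs through [[n, n + 1[]: there the integrand lies between the
    [n]-th term of the series and twice that term ([integral_unit_interval]).

    For the vanishing of supersolutions, suppose that [u] is positive
    somewhere. Let [V_n] be the measure of the ball of radius [n] and let
    [Y_N] ([ball_source]) be the integral of [u ^ q] over the parabolic cylinder
    made of the ball of radius [N] and a time interval of length [N ^ 2]. Fix a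
    level [k > 0], put [w = 1 + u / k] and test the inequality with
    [phi ^ s * h(w)], where [phi] is a space-time cutoff equal to 1 on the
    cylinder of scale [N] and supported in the one of scale [2 N], and
    [h(w) = 1 + w ^ (1/q - 1)]. Three features of [h] matter.
    - It lies between 1 and 2, so the source [u ^ q] survives undamped.
    - It decreases, with [- h'(w)] of order [w ^ - (2 - 1/q)]. This yields a
      Dirichlet energy that absorbs the cross term between the gradients of
      [phi] and [w]. Only the square of the gradient of [phi] is left, so no
      bound on the Laplacian of the distance is ever needed ([edge_ineq],
      [diffusion_ge]).
    - The resulting error [N ^ -2 * phi ^ (s - 2) * w ^ (2 - 1/q)] has an exponent
      in [w] below [q], and it lives where [phi] varies.

    Integrated in time ([energy_balance]), this has two consequences.
    Bounding the error by [w ^ q] on the region between the two cylinders and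
    choosing [k] proportional to [Y_N / V_2N] gives
    [Y_2N - Y_N >= c * N ^ 2 * V_2N ^ (1 - q) * Y_N ^ q]
    ([ball_source_growth], where [k] is still free).
    Choosing instead [k ^ (q - 1)] of order [N ^ -2] lets the source absorb the
    whole error by the Young inequality, which gives the a priori bound
    [N ^ 2 * V_2N ^ (1 - q) * Y_N ^ (q - 1) <= K] ([ball_source_upper]).

    The growth inequality is a discrete version of the differential inequality
    [Y' >= b * Y ^ q]. By large jumps a discrete solution could escape blow-up;
    the a priori bound makes even the scale of a jump contribute in proportion
    to [b = N ^ 2 * V_2N ^ (1 - q)]. Together they say that
    [Y ^ (1 - q)] drops by at least a constant times
    [N ^ 2 * V_2N ^ (1 - q)] from scale [N] to scale [2 N] ([ball_source_step]).
    Since [Y ^ (1 - q)] stays nonnegative, the sum of these quantities over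
    [N = 2 ^ j] is finite, and it dominates the series of
    [n * V_n ^ (1 - q)] by dyadic condensation ([dyadic_block]). *)

(** * The weight h: edge inequality and absorption *)

Ltac nonneg := repeat first
  [ done | by apply: ltW | apply: exprn_ge0 | apply: divr_ge0 | apply: mulr_ge0
  | apply: powR_ge0 | lra | apply: addr_ge0 ].

Lemma nondecreasing_of_derive (R : realType) (f df : R -> R) (a b : R) :
  a <= b -> (forall t, a <= t <= b -> is_derive t 1 f (df t)) ->
  (forall t, a <= t <= b -> 0 <= df t) -> f a <= f b.
Proof.
move=> ab fd d0; rewrite -subr_ge0.
have [||c] := @MVT_segment R f df a b ab.
- by move=> x; rewrite in_itv/= => /andP[ax xb]; apply: fd; rewrite !ltW.
- apply: derivable_within_continuous => x; rewrite in_itv/= => /fd.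
  by case.
rewrite in_itv/= => /d0 dc0 ->; by rewrite mulr_ge0// subr_ge0.
Qed.

Lemma powR_nincr (R : realType) (a x y : R) : a <= 0 -> 0 < x -> x <= y ->
  y `^ a <= x `^ a.
Proof.
move=> a0 x0 xy; have y0 := lt_le_trans x0 xy.
rewrite -(opprK a) !(powRN _ (- a)) lef_pV2 ?posrE ?powR_gt0//.
by apply: ge0_ler_powR => //; rewrite ?nnegrE ?oppr_ge0 ?(ltW x0) ?(ltW y0).
Qed.

(** Negative powers are convex, so they lie above their tangent at [y]. *)
Lemma powR_tangent (R : realType) (a x y : R) : 0 <= a -> 0 < x -> x <= y ->
  a * (y - x) * y `^ (- a - 1) <= x `^ (- a) - y `^ (- a).
Proof.
move=> a0 x0 xy.
have [||c] := @MVT_segment R (fun z : R => z `^ (- a)) (fun c => - a * c `^ (- a - 1)) x y xy.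
- move=> z; rewrite in_itv/= => /andP[xz _].
  by apply: is_derive1_powR; exact: lt_trans xz.
- apply: derivable_within_continuous => z; rewrite in_itv/= => /andP[xz _].
  by have [] := @is_derive1_powR R (- a) z (lt_le_trans x0 xz).
rewrite in_itv/= => /andP[xc cy] E.
have -> : x `^ (- a) - y `^ (- a) = a * (y - x) * c `^ (- a - 1).
  by rewrite -(opprB (y `^ _)) E; ring.
apply: ler_wpM2l; first by rewrite mulr_ge0// subr_ge0.
by apply: powR_nincr; rewrite ?(lt_le_trans x0 xc)//; lra.
Qed.

(** The weight [h] of the introduction. *)
Definition slope (R : realType) (q w : R) : R := 1 + w `^ (q^-1 - 1).
(** The concave antiderivative of [slope q], whose cut-off sum over the vertices
    is differentiated in time. *)
Definition potential (R : realType) (q w : R) : R := w + q * w `^ q^-1.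

Lemma subX_le (R : realDomainType) (a b : R) (n : nat) : 0 <= b -> b <= a ->
  a ^+ n.+1 - b ^+ n.+1 <= n.+1%:R * (a - b) * a ^+ n.
Proof.
move=> b0 ba; have a0 := le_trans b0 ba.
elim: n => [|n IH]; first by rewrite !expr1 expr0 mulr1 mul1r.
have -> : a ^+ n.+2 - b ^+ n.+2 =
  a * (a ^+ n.+1 - b ^+ n.+1) + b ^+ n.+1 * (a - b) by rewrite !exprS; ring.
have -> : n.+2%:R * (a - b) * a ^+ n.+1 =
  a * (n.+1%:R * (a - b) * a ^+ n) + a ^+ n.+1 * (a - b).
  by rewrite (exprS a n) -(natr1 n.+1); ring.
by rewrite lerD ?ler_wpM2l// ler_wpM2r ?subr_ge0// lerXn2r.
Qed.

Section slope_theory.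
Variables (R : realType) (q : R).
Hypothesis q1 : 1 < q.

Lemma exponent_bounds : [/\ 0 < q, 0 < q^-1 & q^-1 < 1].
Proof.
have q0 : 0 < q by exact: lt_trans q1.
by split => //; rewrite ?invr_gt0 ?invf_lt1.
Qed.

Lemma slope_ge1 w : 1 <= slope q w.
Proof. by rewrite /slope lerDl powR_ge0. Qed.

Lemma slope_le2 w : 1 <= w -> slope q w <= 2.
Proof.
have [q0 iq0 iq1] := exponent_bounds.
move=> w1; suff : w `^ (q^-1 - 1) <= 1 by move=> ?; rewrite /slope; lra.
rewrite -[leRHS](powRr0 w); apply: ler_powR => //. lra.
Qed.

Lemma slope_gap x y : 1 <= x -> x <= y ->
  (1 - q^-1) * (y - x) / y `^ (2 - q^-1) <= slope q x - slope q y.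
Proof.
have [q0 iq0 iq1] := exponent_bounds.
move=> x1 xy; have x0 : 0 < x by lra.
have a0 : 0 <= 1 - q^-1 by lra.
have := powR_tangent a0 x0 xy; rewrite -powRN /slope.
have -> : - (1 - q^-1) - 1 = - (2 - q^-1) by ring.
have -> : - (1 - q^-1) = q^-1 - 1 by ring.
by move=> *; lra.
Qed.

Lemma potential_ge0 w : 0 <= w -> 0 <= potential q w.
Proof.
have [q0 iq0 iq1] := exponent_bounds.
by move=> w0; rewrite addr_ge0// mulr_ge0 ?powR_ge0// ltW.
Qed.

Lemma potential_le w : 1 <= w -> potential q w <= (1 + q) * w.
Proof.
have [q0 iq0 iq1] := exponent_bounds.
move=> w1; rewrite mulrDl mul1r lerD2l ler_wpM2l ?(ltW q0)//.
by rewrite ler1_powR// ltW.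
Qed.

Lemma is_derive_potential (w : R) : 0 < w -> is_derive w 1 (potential q) (slope q w).
Proof.
have [q0 iq0 iq1] := exponent_bounds.
move=> w0.
have -> : potential q = id + (q \*: (fun w : R => w `^ q^-1)).
  by apply/funext => z /=.
apply: is_derive_eq; first exact/is_deriveD/is_deriveZ/is_derive1_powR.
by rewrite /slope /GRing.scale/= mulrA mulfV ?mul1r// gt_eqF.
Qed.

Definition edge_cst (m : nat) : R :=
  4 * m.+2%:R + m.+2%:R ^+ 2 * 2 ^+ m.+2 / (1 - q^-1).

Lemma edge_cst_ge0 m : 0 <= edge_cst m.
Proof.
have [q0 iq0 iq1] := exponent_bounds.
have al0 : 0 <= 1 - q^-1 by lra.
by rewrite /edge_cst; nonneg.
Qed.

(** One edge of the Dirichlet form, with cutoff values [a], [b] and function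
    values [y], [x] at its two ends. If [a] and [b] are comparable, the gain
    [slope q x - slope q y] completes the square. Otherwise [a] is at most
    twice [a - b], which already supplies the second factor [a - b]. In both
    cases the error sits at the end where both the cutoff and the function are
    larger, so it vanishes wherever the cutoff does. *)
Lemma edge_ineq (m : nat) (a b x y : R) : 0 <= b -> b <= a -> 1 <= x -> x <= y ->
  - (edge_cst m * (a - b) ^+ 2 * a ^+ m * y `^ (2 - q^-1)) <=
  (y - x) * (b ^+ m.+2 * slope q x - a ^+ m.+2 * slope q y).
Proof.
have [q0 iq0 iq1] := exponent_bounds.
move=> b0 ba x1 xy; have a0 := le_trans b0 ba.
have y1 := le_trans x1 xy.
have := slope_gap x1 xy; have := slope_ge1 y; have := slope_le2 y1.
set hx := slope q x; set hy := slope q y; set P := y `^ _ => hy2 hy1 gap.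
have P0 : 0 < P by rewrite powR_gt0//; lra.
have yP : y <= P by apply: le1r_powR => //; lra.
have yxP : y - x <= P by lra.
pose s : R := m.+2%:R; have s0 : 0 < s by rewrite ltr0n.
pose al : R := 1 - q^-1; have al0 : 0 < al by rewrite /al; lra.
have am0 : 0 <= a ^+ m by rewrite exprn_ge0.
have bs0 : 0 <= b ^+ m.+2 by rewrite exprn_ge0.
have dX : a ^+ m.+2 - b ^+ m.+2 <= s * (a - b) * a ^+ m.+1 by exact: subX_le.
have d0 : 0 <= y - x by rewrite subr_ge0.
have e0 : 0 <= a - b by rewrite subr_ge0.
have splitE : b ^+ m.+2 * hx - a ^+ m.+2 * hy =
  b ^+ m.+2 * (hx - hy) - (a ^+ m.+2 - b ^+ m.+2) * hy by ring.
have err : (a ^+ m.+2 - b ^+ m.+2) * hy <= 2 * s * (a - b) * a ^+ m.+1.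
  apply: (@le_trans _ _ (s * (a - b) * a ^+ m.+1 * hy)).
    by rewrite ler_wpM2r//; lra.
  have : 0 <= s * (a - b) * a ^+ m.+1 by nonneg.
  nra.
have [ab2|ab2] := leP a (2 * b); last first.
- (* Here [a < 2 * (a - b)], which turns one factor [a] into [a - b]. *)
  have hh : 0 <= hx - hy.
    by apply: le_trans gap; nonneg.
  have bh : 0 <= b ^+ m.+2 * (hx - hy) by rewrite mulr_ge0.
  have big : 2 * s * (a - b) * a ^+ m.+1 <= 4 * s * (a - b) ^+ 2 * a ^+ m.
    rewrite exprS.
    have : 0 <= s * (a - b) * a ^+ m by nonneg.
    nra.
  have C1 : 4 * s * ((a - b) ^+ 2 * a ^+ m * P) <= edge_cst m * ((a - b) ^+ 2 * a ^+ m * P).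
    rewrite ler_wpM2r//; first by nonneg.
    by rewrite /edge_cst lerDl; nonneg.
  have D1 : (y - x) * (4 * s * (a - b) ^+ 2 * a ^+ m) <= P * (4 * s * (a - b) ^+ 2 * a ^+ m).
    by rewrite ler_wpM2r//; nonneg.
  have D2 : (y - x) * - (4 * s * (a - b) ^+ 2 * a ^+ m) <=
     (y - x) * (b ^+ m.+2 * hx - a ^+ m.+2 * hy).
    by rewrite ler_wpM2l// splitE; lra.
  lra.
(* Here [b ^ s] is at least [2 ^ - s * a ^ s]: complete the square. *)
have bs : a ^+ m.+2 / 2 ^+ m.+2 <= b ^+ m.+2.
  rewrite ler_pdivrMr ?exprn_gt0// -exprMn.
  by apply: lerXn2r; rewrite ?nnegrE; nonneg.
have good : a ^+ m.+2 / 2 ^+ m.+2 * (al * (y - x) / P) <= b ^+ m.+2 * (hx - hy).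
  by apply: ler_pM; [nonneg|nonneg|exact: bs|exact: gap].
have K0 : 0 < (2 : R) ^+ m.+2 by rewrite exprn_gt0.
have main : 2 * s * (a - b) * a ^+ m.+1 * (y - x) <=
   a ^+ m.+2 / 2 ^+ m.+2 * (al * (y - x) / P) * (y - x) +
   s ^+ 2 * 2 ^+ m.+2 / al * (a - b) ^+ 2 * a ^+ m * P.
  pose X := a * (y - x); pose Y := s * (a - b).
  pose c := al / (2 ^+ m.+2 * P).
  have c0 : 0 < c by rewrite divr_gt0// mulr_gt0.
  have -> : 2 * s * (a - b) * a ^+ m.+1 * (y - x) = a ^+ m * (2 * X * Y).
    by rewrite /X /Y exprS; ring.
  have -> : a ^+ m.+2 / 2 ^+ m.+2 * (al * (y - x) / P) * (y - x) +
    s ^+ 2 * 2 ^+ m.+2 / al * (a - b) ^+ 2 * a ^+ m * P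
    = a ^+ m * (c * X ^+ 2 + Y ^+ 2 / c).
    rewrite /X /Y /c 2!exprS; field; rewrite !gt_eqF//.
  apply: ler_wpM2l => //.
  rewrite -subr_ge0.
  have -> : c * X ^+ 2 + Y ^+ 2 / c - 2 * X * Y = (c * X - Y) ^+ 2 / c.
    by field; rewrite gt_eqF.
  by rewrite divr_ge0 ?sqr_ge0// ltW.
have C2 : s ^+ 2 * 2 ^+ m.+2 / al * ((a - b) ^+ 2 * a ^+ m * P) <=
   edge_cst m * ((a - b) ^+ 2 * a ^+ m * P).
  rewrite ler_wpM2r//; first by nonneg.
  rewrite /edge_cst lerDr; nonneg.
have D : (y - x) * (a ^+ m.+2 / 2 ^+ m.+2 * (al * (y - x) / P) - 2 * s * (a - b) * a ^+ m.+1)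
  <= (y - x) * (b ^+ m.+2 * hx - a ^+ m.+2 * hy).
  by rewrite ler_wpM2l// splitE; lra.
by move=> *; lra.
Qed.

Lemma slope_nincr x y : 1 <= x -> x <= y -> slope q y <= slope q x.
Proof.
have [q0 iq0 iq1] := exponent_bounds.
move=> x1 xy; rewrite -subr_ge0; apply: le_trans (slope_gap x1 xy).
by nonneg.
Qed.

(** When the cutoff and the function vary in opposite directions the edge
    contributes with the good sign. *)
Lemma edge_ineq_ge0 (m : nat) (a b x y : R) : 0 <= a -> a <= b -> 1 <= x -> x <= y ->
  0 <= (y - x) * (b ^+ m.+2 * slope q x - a ^+ m.+2 * slope q y).
Proof.
have [q0 iq0 iq1] := exponent_bounds.
move=> a0 ab x1 xy; rewrite mulr_ge0 ?subr_ge0//.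
apply: ler_pM; rewrite ?exprn_ge0 ?slope_nincr//.
- exact: le_trans (slope_ge1 _).
- by rewrite lerXn2r ?nnegrE// (le_trans a0).
Qed.

End slope_theory.

Section absorption.
Variables (R : realType) (q : R).
Hypothesis q1 : 1 < q.

Lemma powR_1D_le (y : R) : 0 <= y -> (1 + y) `^ q <= 2 `^ q * (1 + y `^ q).
Proof.
move=> y0; have q0 := ltW (lt_trans ltr01 q1).
have [y1|y1] := leP y 1.
  apply: (@le_trans _ _ (2 `^ q)).
    by apply: ge0_ler_powR => //; rewrite ?nnegrE; lra.
  by rewrite ler_peMr ?powR_ge0// lerDl powR_ge0.
apply: (@le_trans _ _ ((2 * y) `^ q)).
  by apply: ge0_ler_powR => //; rewrite ?nnegrE; lra.
by rewrite powRM// ler_wpM2l ?powR_ge0// lerDr.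
Qed.

(** The Young inequality in a form that also trades powers of the cutoff: the
    loss of two powers of [a] is paid by the gap [q - p], provided that [a]
    comes with a high enough power. *)
Lemma absorb (p e a w : R) (m : nat) : 0 < p -> p < q -> 0 < e ->
  0 <= a -> 1 <= w -> 2 * (p / (q - p)) <= m%:R -> a <= 1 ->
  a ^+ m * w `^ p <= e * (a ^+ m.+2 * w `^ q) + e^-1 `^ (p / (q - p)).
Proof.
move=> p0 pq e0 a0 w1 hm a1.
have w0 : 0 < w by lra.
have qp0 : 0 < q - p by lra.
set r := p / (q - p); have r0 : 0 < r by rewrite divr_gt0.
have wq : w `^ q = w `^ p * w `^ (q - p).
  by rewrite -powRD ?(gt_eqF w0) ?implybT//; congr (_ `^ _); ring.
have am0 : 0 <= a ^+ m by exact: exprn_ge0.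
have wp0 : 0 < w `^ p by rewrite powR_gt0.
have [big|small] := leP e^-1 (a ^+ 2 * w `^ (q - p)).
  rewrite -[leLHS]addr0; apply: lerD; last exact: powR_ge0.
  have -> : e * (a ^+ m.+2 * w `^ q) =
      (a ^+ m * w `^ p) * (e * (a ^+ 2 * w `^ (q - p))).
    by rewrite wq -addn2 exprD; ring.
  rewrite ler_peMr//; first by nonneg.
  by rewrite -ler_pdivrMl// mulr1.
rewrite -[leLHS]add0r; apply: lerD.
  by nonneg.
apply: (@le_trans _ _ ((a ^+ 2 * w `^ (q - p)) `^ r)); last first.
  apply: ge0_ler_powR; rewrite ?nnegrE ?invr_ge0 ?(ltW small); nonneg.
rewrite powRM ?exprn_ge0 ?powR_ge0// -powRrM (mulrC (q - p)) divfK ?gt_eqF//.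
rewrite ler_wpM2r ?(ltW wp0)// -!powR_mulrn// -powRrM.
have [->|an0] := eqVneq a 0.
  have r20 : 0 < 2 * r by rewrite mulr_gt0.
  by rewrite !powR0 ?gt_eqF// (lt_le_trans r20).
by apply: ger_powR => //; rewrite lt_neqAle eq_sym an0 a0.
Qed.

Lemma absorb_error (p E a y : R) (m : nat) : 0 < p -> p < q -> 0 < E ->
  0 <= a -> a <= 1 -> 0 <= y -> 2 * (p / (q - p)) <= m%:R ->
  E * (a ^+ m * (1 + y) `^ p) <=
  2 `^ q * (a ^+ m.+2 * y `^ q) + (2 `^ q + E * E `^ (p / (q - p))).
Proof.
move=> p0 pq E0 a0 a1 y0 hm.
have w1 : 1 <= 1 + y by lra.
have iE0 : 0 < E^-1 by rewrite invr_gt0.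
have := absorb p0 pq iE0 a0 w1 hm a1.
rewrite invrK -(ler_pM2l E0) mulrDr (mulrA E E^-1) mulfV ?gt_eqF// mul1r => h.
apply: (le_trans h); rewrite addrA lerD2r.
have A0 : 0 <= a ^+ m.+2 by rewrite exprn_ge0.
have A1 : a ^+ m.+2 <= 1 by rewrite exprn_ile1.
apply: (le_trans (ler_wpM2l A0 (powR_1D_le y0))).
have : 0 <= 2 `^ q :> R by exact: powR_ge0.
nra.
Qed.

End absorption.

(** * Antiderivatives of continuous functions on the half-line *)

(** The absolute value is there because the real power is not continuous at 0
    from the left. *)
Lemma continuous_norm_powR (R : realType) (q : R) : 1 < q ->
  continuous (fun x : R => `|x| `^ q).
Proof.
move=> q1 x; have [->|x0] := eqVneq x 0.
  rewrite /continuous_at normr0 powR0; last by rewrite gt_eqF// (lt_trans ltr01).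
  apply: (@squeeze_cvgr _ _ _ _ (cst 0) (fun x : R => `|x|)).
  - near=> y; rewrite powR_ge0/=.
    have [->|y0] := eqVneq y 0.
      by rewrite normr0 powR0// gt_eqF// (lt_trans ltr01).
    rewrite ge1r_powR ?(ltW q1)// normr_gt0 y0/=.
    near: y; apply/nbhs_ballP; exists 1 => //= y.
    by rewrite /ball/= sub0r normrN => /ltW.
  - exact: cvg_cst.
  - by rewrite -[X in _ --> X](@normr0 R R); exact: norm_continuous.
apply: (@continuous_comp _ _ _ (fun x : R => `|x|) (fun x : R => x `^ q)).
  exact: norm_continuous.
apply: differentiable_continuous; apply/derivable1_diffP.
by have [] := @is_derive1_powR R q `|x| _; rewrite ?normr_gt0.
Unshelve. all: by end_near. Qed.

(** The source terms are only followed through these antiderivatives, so that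
    all comparisons in time are between derivatives. *)
Lemma antiderivative (R : realType) (f : R -> R) (t0 : R) : 0 < t0 ->
  (forall t, 0 < t -> {for t, continuous f}) ->
  exists F : R -> R, F t0 = 0 /\ forall t, t0 <= t -> is_derive t 1 F (f t).
Proof.
move=> t00 fc; pose a := t0 / 2.
have a0 : 0 < a by rewrite divr_gt0.
pose g t := f (Num.max a t).
have gc : continuous g.
  move=> t; apply: (@continuous_comp _ _ _ (fun t => Num.max a t) f).
    by apply: (@continuous_max R _ (cst a) id); [exact: cvg_cst|exact: cvg_id].
  by apply: fc; rewrite lt_max a0.
pose F t := \int[lebesgue_measure]_(x in `[a, t]) g x.
exists (fun t => F t - F t0); split; first by rewrite subrr.
move=> t t0t; have at0 : a < t by rewrite /a; lra.
have ig : lebesgue_measure.-integrable `[a, t + 1] (EFin \o g).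
  apply: continuous_compact_integrable; first exact: segment_compact.
  exact: continuous_subspaceT.
have tt1 : t < t + 1 by lra.
have [dF F'] := continuous_FTC1_closed tt1 ig at0 (gc t).
have -> : (fun t => F t - F t0) = F - cst (F t0) by [].
apply: is_derive_eq; first apply: is_deriveB.
  exact: derivableP.
rewrite subr0 -derive1E F' /g; congr f; exact/max_r/ltW.
Qed.

(** * Balls and summation by parts on a weighted graph *)

Section graph.
Variables (R : realType) (G : weighted_graph R) (o : G).

Lemma graph_dist_adj (x y : G) : adj x y -> (graph_dist o y <= (graph_dist o x).+1)%N.
Proof.
move=> xy; rewrite /graph_dist.
case: ex_minnP => n _ minn; case: ex_minnP => k /asboolP[p [op px <-]] _.
apply: minn; apply/asboolP; exists (rcons p y).
by rewrite rcons_path op px xy last_rcons size_rcons.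
Qed.

Lemma graph_dist_pred (y : G) n : graph_dist o y = n.+1 ->
  exists2 x : G, adj x y & (graph_dist o x <= n)%N.
Proof.
rewrite /graph_dist; case: ex_minnP => k /asboolP[p [op pxy <-]] _.
case: (lastP p) op pxy => // s z; rewrite rcons_path last_rcons size_rcons.
move=> /andP[os sz] <- [<-]; exists (last o s) => //.
by case: ex_minnP => j _; apply; apply/asboolP; exists s.
Qed.

Lemma graph_dist_eq0 (y : G) : graph_dist o y = 0%N -> y = o.
Proof.
rewrite /graph_dist; case: ex_minnP => k /asboolP[p [_ + <-]] _ p0.
by rewrite (size0nil p0).
Qed.

Lemma graph_ballE n : graph_ball o n%:R = [set x : G | (graph_dist o x <= n)%N].
Proof. by apply/seteqP; split => x /=; rewrite /graph_ball/= ler_nat. Qed.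

Lemma finite_graph_ball n : finite_set (graph_ball o n%:R).
Proof.
rewrite graph_ballE; elim: n => [|n IH].
  apply: (@sub_finite_set _ _ [set o]) => [x /=|]; last exact: finite_set1.
  by rewrite leqn0 => /eqP/graph_dist_eq0.
apply: (@sub_finite_set _ _ ([set x | (graph_dist o x <= n)%N] `|`
  \bigcup_(x in [set x | (graph_dist o x <= n)%N]) [set y | adj x y])).
  move=> x /=; rewrite leq_eqVlt ltnS => /predU1P[/graph_dist_pred[y yx yn]|?].
  - by right; exists y.
  - by left.
rewrite finite_setU; split => //; apply: bigcup_finite => // x _.
exact: adj_locally_finite.
Qed.

Definition ball_seq n : seq G := finmap.enum_fset (fset_set (graph_ball o n%:R)).

Lemma mem_ball_seq n x : (x \in ball_seq n) = (graph_dist o x <= n)%N.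
Proof.
have xE := in_fset_set (@finite_graph_ball n) x.
rewrite [LHS]xE graph_ballE; apply/idP/idP; by rewrite inE.
Qed.

Lemma ball_seq_uniq n : uniq (ball_seq n).
Proof. exact: finmap.fset_uniq. Qed.

Lemma sum_ball_seq (F : G -> R) n k : (n <= k)%N ->
  \sum_(x <- ball_seq n) F x =
  \sum_(x <- ball_seq k) (if (graph_dist o x <= n)%N then F x else 0).
Proof.
move=> nk; rewrite -big_mkcond/= -[RHS]big_filter; apply: perm_big.
apply: uniq_perm; rewrite ?filter_uniq ?ball_seq_uniq// => x.
rewrite mem_filter !mem_ball_seq; apply/idP/andP => [xn|[]//].
by split => //; exact: leq_trans nk.
Qed.

Lemma set_measure_ball n :
  set_measure (graph_ball o n%:R) = \sum_(x <- ball_seq n) vertex_measure x.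
Proof. by rewrite /set_measure fsbig_finite//; exact: finite_graph_ball. Qed.

Lemma sum_neighbours (F : G -> R) (x : G) n : (graph_dist o x < n)%N ->
  (forall y, ~~ adj x y -> F y = 0) ->
  \sum_(y \in [set y | adj x y]) F y = \sum_(y <- ball_seq n) F y.
Proof.
move=> xn F0; rewrite (@fsbig_widen _ _ _ _ _ (graph_ball o n%:R)).
- by rewrite fsbig_finite//; exact: finite_graph_ball.
- move=> y /= /graph_dist_adj yx; rewrite graph_ballE/=.
  exact: leq_trans xn.
- by move=> y /= [_ /negP]; exact: F0.
Qed.

Lemma exists_adj (x : G) : exists y, adj x y.
Proof.
have [y yx] : exists y : G, y != x.
  apply: contrapT => h; apply: (@vertex_infinite _ G).
  apply: (@sub_finite_set _ _ [set x]); last exact: finite_set1.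
  by move=> y _ /=; apply/eqP; apply: contrapT => /negP ?; apply: h; exists y.
have [[|z p] [/= xp py]] := adj_connected x y; first by rewrite py eqxx in yx.
by exists z; case/andP: xp.
Qed.

Lemma vertex_measure_gt0 (x : G) : 0 < vertex_measure x.
Proof.
have [y xy] := exists_adj x.
rewrite /vertex_measure fsbig_finite; last exact: adj_locally_finite.
have yin : y \in finmap.enum_fset (fset_set [set y | adj x y]).
  have yE := in_fset_set (adj_locally_finite x) y.
  by rewrite [_ \in _]yE inE.
rewrite (bigD1_seq y yin (finmap.fset_uniq _))/=.
rewrite ltr_pwDl ?weight_gt0// sumr_ge0// => z _; exact: weight_ge0.
Qed.

Lemma ball_measure_gt0 n : 0 < set_measure (graph_ball o n%:R).
Proof.
rewrite set_measure_ball.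
have oin : o \in ball_seq n.
  rewrite mem_ball_seq /graph_dist; case: ex_minnP => k _ mink.
  by apply: leq_trans (mink 0%N _) _ => //; apply/asboolP; exists [::].
rewrite (bigD1_seq o oin (ball_seq_uniq n))/=.
rewrite ltr_pwDl ?vertex_measure_gt0// sumr_ge0// => z _.
exact/ltW/vertex_measure_gt0.
Qed.

Lemma ball_measure_le n k : (n <= k)%N ->
  set_measure (graph_ball o n%:R) <= set_measure (graph_ball o k%:R).
Proof.
move=> nk; rewrite !set_measure_ball (sum_ball_seq _ nk).
apply: ler_sum => x _; case: ifP => // _; exact/ltW/vertex_measure_gt0.
Qed.

Lemma laplacian_affine (f : G -> R) (c k : R) (x : G) :
  laplacian (fun y => c + f y / k) x = laplacian f x / k.
Proof.
rewrite /laplacian -mulrA; congr (_ * _).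
rewrite !fsbig_finite; [|exact: adj_locally_finite..].
rewrite mulr_suml; apply: eq_bigr => y _; ring.
Qed.

(** Summation by parts: the boundary term vanishes because [f] is supported
    in the smaller ball. *)
Lemma green (f w : G -> R) n : (forall x, (n < graph_dist o x)%N -> f x = 0) ->
  \sum_(x <- ball_seq n) vertex_measure x * (f x * laplacian w x) =
  2^-1 * \sum_(x <- ball_seq n.+1) \sum_(y <- ball_seq n.+1)
     weight x y * ((w y - w x) * (f x - f y)).
Proof.
move=> f0.
pose S := ball_seq n.+1.
have -> : \sum_(x <- ball_seq n) vertex_measure x * (f x * laplacian w x) =
  \sum_(x <- S) \sum_(y <- S) weight x y * ((w y - w x) * f x).
  rewrite (sum_ball_seq _ (leqnSn n)); apply: eq_bigr => x _.
  case: leqP => [xn|xn]; last first.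
    by rewrite big1// => y _; rewrite f0// !mulr0.
  rewrite /laplacian mulrCA mulVKf ?gt_eqF ?vertex_measure_gt0//; last first.
  rewrite (@sum_neighbours _ x n.+1)//.
    by rewrite mulr_sumr; apply: eq_bigr => y _; ring.
  by move=> y xy; rewrite weight_eq0// mul0r.
have E : \sum_(x <- S) \sum_(y <- S) weight x y * ((w y - w x) * f x) =
         - \sum_(x <- S) \sum_(y <- S) weight x y * ((w y - w x) * f y).
  rewrite exchange_big/= -sumrN; apply: eq_bigr => x _.
  rewrite -sumrN; apply: eq_bigr => y _; rewrite weight_sym; ring.
have -> : \sum_(x <- S) \sum_(y <- S) weight x y * ((w y - w x) * (f x - f y)) =
   \sum_(x <- S) \sum_(y <- S) weight x y * ((w y - w x) * f x) -
   \sum_(x <- S) \sum_(y <- S) weight x y * ((w y - w x) * f y).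
  rewrite -sumrB; apply: eq_bigr => x _; rewrite -sumrB; apply: eq_bigr => y _.
  ring.
lra.
Qed.

End graph.

(** * Diffusion of the cut-off mass *)

Section cutoff.
Variables (R : realType) (G : weighted_graph R) (o : G) (N : nat).
Hypothesis N0 : (0 < N)%N.

(** The plateau reaches radius [N + 1] rather than [N], so that along an edge
    where the cutoff varies the end with the larger value still lies beyond
    [N]; the truncated subtraction makes the cutoff vanish beyond radius
    [2 N]. *)
Definition cutoff (x : G) : R := (minn ((2 * N).+1 - graph_dist o x) N)%:R / N%:R.

Let NR0 : 0 < N%:R :> R. Proof. by rewrite ltr0n. Qed.

Lemma cutoff_ge0 x : 0 <= cutoff x.
Proof. by rewrite divr_ge0. Qed.

Lemma cutoff_le1 x : cutoff x <= 1.
Proof. by rewrite ler_pdivrMr// mul1r ler_nat geq_minr. Qed.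

Lemma cutoff_eq1 x : (graph_dist o x <= N.+1)%N -> cutoff x = 1.
Proof.
move=> xN; rewrite /cutoff (minn_idPr _) ?divff ?gt_eqF//; lia.
Qed.

Lemma cutoff_eq0 x : (2 * N < graph_dist o x)%N -> cutoff x = 0.
Proof.
move=> xN; rewrite /cutoff (_ : _ - _ = 0)%N ?min0n ?mul0r//; lia.
Qed.

Lemma cutoff_adj x y : adj x y -> cutoff x < cutoff y ->
  cutoff y - cutoff x <= N%:R^-1 /\ (N < graph_dist o y)%N.
Proof.
move=> xy lt_xy; have := graph_dist_adj o xy; have yx : adj y x by rewrite adj_sym.
have := graph_dist_adj o yx => dxy dyx; split; last first.
  rewrite ltnNge; apply/negP => yN; move: lt_xy.
  by rewrite (@cutoff_eq1 y) ?(@cutoff_eq1 x) ?ltxx//; lia.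
rewrite /cutoff -mulrBl ler_pdivrMr// mulVf ?gt_eqF// lerBlDl natr1 ler_nat.
lia.
Qed.

Section diffusion.
Variables (q : R) (m : nat).
Hypotheses (q1 : 1 < q) (m0 : (0 < m)%N).

(** The density of the error in the edge inequality; the indicator records that
    it lives outside the ball of radius [N]. *)
Definition cut_error (w : R) (x : G) : R :=
  edge_cst q m / N%:R ^+ 2 * ((N < graph_dist o x)%N%:R * (cutoff x ^+ m * w `^ (2 - q^-1))).

Lemma cut_error_ge0 w x : 0 <= cut_error w x.
Proof.
rewrite /cut_error; have := edge_cst_ge0 q1 m; have := cutoff_ge0 x => *.
by nonneg.
Qed.

Lemma cut_error_eq0 w x : (2 * N < graph_dist o x)%N -> cut_error w x = 0.
Proof.
by move=> xN; rewrite /cut_error cutoff_eq0// expr0n gtn_eqF//= mul0r !mulr0.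
Qed.

Let flux (w : G -> R) x : R := cutoff x ^+ m.+2 * slope q (w x).

(** The error is charged to the end with the larger cutoff, where
    [cutoff_adj] applies. *)
Lemma flux_edge (w : G -> R) x y : adj x y -> 1 <= w x -> 1 <= w y ->
  - (cut_error (w x) x + cut_error (w y) y) <= (w y - w x) * (flux w x - flux w y).
Proof.
wlog xy : x y / w x <= w y => [th|] axy wx wy.
  have [|/ltW] := leP (w x) (w y) => h; first exact: th.
  rewrite addrC (_ : _ * _ = (w x - w y) * (flux w y - flux w x)); last by ring.
  by apply: th => //; rewrite adj_sym.
have [yx|lt_xy] := leP (cutoff y) (cutoff x).
  apply: (@le_trans _ _ 0); last exact: edge_ineq_ge0 (cutoff_ge0 _) _ _ _.
  by rewrite oppr_le0 addr_ge0// cut_error_ge0.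
apply: le_trans (edge_ineq q1 m (cutoff_ge0 x) (ltW lt_xy) wx xy).
rewrite lerN2; apply: (@le_trans _ _ (cut_error (w y) y)); last first.
  by rewrite lerDr cut_error_ge0.
have [dN yN] := cutoff_adj axy lt_xy.
rewrite /cut_error yN mul1r [leRHS]mulrA.
have P0 := powR_ge0 (w y) (2 - q^-1).
apply: ler_wpM2r => //; apply: ler_wpM2r; first exact/exprn_ge0/cutoff_ge0.
apply: ler_wpM2l; first exact: edge_cst_ge0.
by rewrite -exprVn lerXn2r// nnegrE ?invr_ge0// subr_ge0 ltW.
Qed.

(** Every edge meets its two error terms once; summed over the other end, the
    weights add up to the vertex measure, which the normalized Laplacian
    divides by. *)
Lemma diffusion_ge (w : G -> R) : (forall x, 1 <= w x) ->
  - \sum_(x <- ball_seq o (2 * N)) vertex_measure x * cut_error (w x) x <=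
  \sum_(x <- ball_seq o (2 * N)) vertex_measure x * (flux w x * laplacian w x).
Proof.
move=> w1; rewrite green; last first.
  by move=> x xN; rewrite /flux cutoff_eq0// expr0n/= mul0r.
set S := ball_seq o (2 * N).+1; pose e x := cut_error (w x) x.
have W : \sum_(x <- S) \sum_(y <- S) weight x y * e x =
         \sum_(x <- ball_seq o (2 * N)) vertex_measure x * e x.
  rewrite (sum_ball_seq _ _ (leqnSn (2 * N))); apply: eq_bigr => x _.
  case: leqP => [xn|xn]; last by rewrite big1// => y _; rewrite /e cut_error_eq0// mulr0.
  rewrite -mulr_suml; congr (_ * _).
  by rewrite /vertex_measure (@sum_neighbours _ _ o _ x (2 * N).+1)// => y; exact: weight_eq0.
have W2 : \sum_(x <- S) \sum_(y <- S) weight x y * e y =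
         \sum_(x <- ball_seq o (2 * N)) vertex_measure x * e x.
  rewrite -W exchange_big/=; apply: eq_bigr => x _; apply: eq_bigr => y _.
  by rewrite weight_sym.
have -> : - \sum_(x <- ball_seq o (2 * N)) vertex_measure x * e x =
  2^-1 * \sum_(x <- S) \sum_(y <- S) weight x y * - (e x + e y).
  have -> : \sum_(x <- S) \sum_(y <- S) weight x y * - (e x + e y) =
    - (\sum_(x <- S) \sum_(y <- S) weight x y * e x +
       \sum_(x <- S) \sum_(y <- S) weight x y * e y).
    rewrite -big_split/= -sumrN; apply: eq_bigr => x _.
    by rewrite -big_split/= -sumrN; apply: eq_bigr => y _; ring.
  by rewrite W W2; lra.
rewrite ler_wpM2l//; apply: ler_sum => x _; apply: ler_sum => y _.
have [xy|xy] := boolP (adj x y); last by rewrite weight_eq0// !mul0r.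
by rewrite ler_wpM2l ?weight_ge0// flux_edge.
Qed.

End diffusion.
End cutoff.

(** * The energy balance *)

Lemma is_derive_sum_seq (R : realType) (I : Type) (S : seq I) (f : I -> R -> R)
    (df : I -> R) (t : R) :
  (forall x, is_derive t 1 (f x) (df x)) ->
  is_derive t 1 (fun r => \sum_(x <- S) f x r) (\sum_(x <- S) df x).
Proof.
move=> fd; elim: S => [|x S IH].
  rewrite big_nil (_ : (fun _ => _) = cst 0); first exact: is_derive_cst.
  by apply/funext => r; rewrite big_nil.
rewrite big_cons (_ : (fun _ => _) = f x + (fun r => \sum_(x <- S) f x r)).
  exact: is_deriveD.
by apply/funext => r; rewrite big_cons.
Qed.

Lemma is_deriveZr (R : realType) (f : R -> R) (k t df : R) :
  is_derive t 1 f df -> is_derive t 1 (fun r => k * f r) (k * df).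
Proof. exact: is_deriveZ. Qed.

Section energy.
Variables (R : realType) (G : weighted_graph R) (o : G) (q : R) (u : R -> G -> R).
Variables (m N : nat) (k : R).
Hypotheses (q1 : 1 < q) (hu : nonneg_supersolution q u).
Hypotheses (m0 : (0 < m)%N) (N0 : (0 < N)%N) (k0 : 0 < k).

Local Notation B := (ball_seq o (2 * N)).
Local Notation phi := (cutoff o N).
Local Notation mu := vertex_measure.
Local Notation T := (N%:R ^+ 2 : R).
Local Notation w t x := (1 + u t x / k).

Definition mass (t : R) : R :=
  \sum_(x <- B) mu x * (phi x ^+ m.+2 * potential q (w t x)).

Definition mass_rate (t : R) : R :=
  \sum_(x <- B) mu x * (phi x ^+ m.+2 * (slope q (w t x) * (derive1 (u^~ x) t / k))).

Let w1 (t : R) x : 0 < t -> 1 <= w t x.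
Proof. by case: hu => u0 _ _ _ t0; rewrite lerDl divr_ge0 ?u0// ltW. Qed.

Lemma is_derive_mass (t : R) : 0 < t -> is_derive t 1 mass (mass_rate t).
Proof.
move=> t0; apply: is_derive_sum_seq => x.
apply: is_deriveZr; apply: is_deriveZr.
have wt : 0 < w t x by apply: lt_le_trans (w1 x t0).
apply: (@is_derive1_comp R (potential q) (fun r => w r x)).
  exact: is_derive_potential.
case: hu => _ /(_ t x t0)/derivableP ud _ _.
have -> : (fun r => w r x) = cst 1 + (k^-1 \*: (u^~ x)).
  by apply/funext => r /=; rewrite /cst/= mulrC.
apply: is_derive_eq; rewrite add0r -derive1E; exact: mulrC.
Qed.

(** As the slope is at least 1, the source is not damped by the test function. *)
Lemma mass_rate_ge (t : R) : 0 < t ->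
  \sum_(x <- B) mu x * (phi x ^+ m.+2 * (u t x `^ q / k) - cut_error o N q m (w t x) x)
  <= mass_rate t.
Proof.
move=> t0.
have D := diffusion_ge o N0 q1 m0 (fun x => w1 x t0).
apply: (@le_trans _ _ (\sum_(x <- B) mu x * (phi x ^+ m.+2 * (u t x `^ q / k)) +
  \sum_(x <- B) mu x * (phi x ^+ m.+2 * slope q (w t x) * laplacian (fun y => w t y) x))).
  rewrite (eq_bigr (fun x => mu x * (phi x ^+ m.+2 * (u t x `^ q / k)) -
     mu x * cut_error o N q m (w t x) x)); last by move=> x _; rewrite mulrBr.
  by rewrite sumrB lerD2l.
rewrite -big_split/=; apply: ler_sum => x _; rewrite -mulrDr.
apply: ler_wpM2l; first exact/ltW/vertex_measure_gt0.
rewrite -mulrA -mulrDr; apply: ler_wpM2l; first exact/exprn_ge0/cutoff_ge0.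
have h1 := slope_ge1 q (w t x).
case: hu => u0 _ _ /(_ t x t0) sup.
rewrite laplacian_affine.
have P0 : 0 <= u t x `^ q / k by rewrite divr_ge0 ?powR_ge0// ltW.
have : (laplacian (u t) x + u t x `^ q) / k <= derive1 (u^~ x) t / k.
  by rewrite ler_pM2r ?invr_gt0//; lra.
rewrite mulrDl => le.
apply: le_trans (ler_wpM2l (le_trans ler01 h1) le).
by rewrite mulrDr addrC lerD2l ler_peMl.
Qed.

(** The time cutoff has slope [N ^ -2] and enters to the power [m.+2], and
    [potential q w] is at most [(1 + q) * w]; this gives the second summand. *)
Definition time_error : R := edge_cst q m + m.+2%:R * (1 + q).

(** On the first time interval of length [N ^ 2] only the space cutoff acts; on
    the second one the factor [c] goes linearly from 1 to 0. The hypotheses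
    bound the integrand pointwise from below by [al1 x * u ^ q - b] and
    [al2 x * u ^ q - b], so that a single integration serves both the growth
    inequality and the a priori bound. *)
Lemma energy_balance (U : G -> R -> R) (t0 b : R) (al1 al2 : G -> R) : 0 < t0 ->
  (forall x, U x t0 = 0) ->
  (forall x t, t0 <= t -> is_derive t 1 (U x) (u t x `^ q)) ->
  (forall (x : G) (z : R), (graph_dist o x <= 2 * N)%N -> 0 <= z ->
     al1 x * z `^ q - b <=
     phi x ^+ m.+2 * (z `^ q / k) - cut_error o N q m (1 + z / k) x) ->
  (forall (x : G) (z c : R), (graph_dist o x <= 2 * N)%N -> 0 <= z -> 0 <= c <= 1 ->
     al2 x * z `^ q - b <= (c * phi x) ^+ m.+2 * (z `^ q / k) -
       time_error / T * ((c * phi x) ^+ m * (1 + z / k) `^ (2 - q^-1))) ->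
  \sum_(x <- B) mu x * (al1 x * U x (t0 + T) + al2 x * (U x (t0 + 2 * T) - U x (t0 + T)))
  <= 2 * T * b * set_measure (graph_ball o (2 * N)%:R).
Proof.
move=> t00 U0 hU H1 H2.
have T0 : 0 < T by rewrite exprn_gt0// ltr0n.
have u0 (t : R) x : 0 < t -> 0 <= u t x by case: hu => h _ _ _ ?; exact: h.
have mu0 (x : G) : 0 <= mu x := ltW (vertex_measure_gt0 x).
pose A (al : G -> R) t := \sum_(x <- B) mu x * (al x * U x t - b * t).
have dA al (t : R) : t0 <= t -> is_derive t 1 (A al) (\sum_(x <- B) mu x * (al x * u t x `^ q - b)).
  move=> tt; apply: is_derive_sum_seq => x; apply: is_deriveZr.
  apply: is_deriveB; first exact/is_deriveZr/hU.
  by rewrite -[X in is_derive _ _ _ X]mulr1; exact: is_deriveZr.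
have I1 : mass t0 - A al1 t0 <= mass (t0 + T) - A al1 (t0 + T).
  apply: (@nondecreasing_of_derive R (mass - A al1) (fun t => mass_rate t -
    \sum_(x <- B) mu x * (al1 x * u t x `^ q - b))); first by lra.
  - move=> t /andP[tt _]; apply: is_deriveB; last exact: dA.
    by apply: is_derive_mass; lra.
  - move=> t /andP[tt _]; have t_gt0 : 0 < t by lra.
    rewrite subr_ge0; apply: le_trans (mass_rate_ge t_gt0).
    rewrite big_seq [leRHS]big_seq; apply: ler_sum => x; rewrite mem_ball_seq => xB.
    by apply: ler_wpM2l; [exact: mu0|apply: H1 => //; exact: u0].
pose chi t := (t0 + 2 * T - t) / T.
have dchi (t : R) : is_derive t 1 chi (- T^-1).
  rewrite (_ : chi = (fun t => T^-1 * (t0 + 2 * T - t))); last first.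
    by apply/funext => r; rewrite mulrC.
  rewrite -[X in is_derive _ _ _ X]mulrN1; apply: is_deriveZr.
  have -> : (fun r : R => t0 + 2 * T - r) = cst (t0 + 2 * T) - id by [].
  by apply: is_derive_eq; rewrite sub0r.
have dpow (t : R) : is_derive t 1 (fun r => chi r ^+ m.+2) (m.+2%:R * chi t ^+ m.+1 * (- T^-1)).
  have -> : (fun r => chi r ^+ m.+2) = chi ^+ m.+2.
    by apply/funext => r; rewrite exprfctE.
  exact: is_deriveX.
have I2 : mass (t0 + T) - A al2 (t0 + T) <= - A al2 (t0 + 2 * T).
  have -> : mass (t0 + T) = chi (t0 + T) ^+ m.+2 * mass (t0 + T).
    by rewrite /chi (_ : t0 + 2 * T - _ = T) ?divff ?gt_eqF// ?expr1n ?mul1r//; ring.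
  have -> : - A al2 (t0 + 2 * T) =
      chi (t0 + 2 * T) ^+ m.+2 * mass (t0 + 2 * T) - A al2 (t0 + 2 * T).
    by rewrite /chi subrr mul0r expr0n/= mul0r sub0r.
  apply: (@nondecreasing_of_derive R ((fun r => chi r ^+ m.+2) * mass - A al2)
    (fun t => (chi t ^+ m.+2 * mass_rate t +
       mass t * (m.+2%:R * chi t ^+ m.+1 * (- T^-1))) -
    \sum_(x <- B) mu x * (al2 x * u t x `^ q - b))); first by lra.
  - move=> t /andP[tt _]; apply: is_deriveB; last by apply: dA; lra.
    apply: is_deriveM.
    by apply: is_derive_mass; lra.
  - move=> t /andP[tt t2]; have t_gt0 : 0 < t by lra.
    have c0 : 0 <= chi t by rewrite divr_ge0 ?(ltW T0)//; lra.
    have c1 : chi t <= 1 by rewrite ler_pdivrMr//; lra.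
    have cm0 : 0 <= chi t ^+ m.+2 by exact: exprn_ge0.
    move: (chi t) c0 c1 cm0 => c c0 c1 cm0.
    rewrite subr_ge0.
    apply: (@le_trans _ _ (c ^+ m.+2 * (\sum_(x <- B) mu x * (phi x ^+ m.+2 * (u t x `^ q / k) -
       cut_error o N q m (w t x) x)) +  mass t * (m.+2%:R * c ^+ m.+1 * (- T^-1)))); last first.
      by rewrite lerD2r ler_wpM2l// mass_rate_ge.
    rewrite mulr_sumr mulr_suml -big_split/=.
    rewrite big_seq [leRHS]big_seq; apply: ler_sum => x; rewrite mem_ball_seq => xB.
    apply: (@le_trans _ _ (mu x * ((c * phi x) ^+ m.+2 * (u t x `^ q / k) -
       time_error / T * ((c * phi x) ^+ m * (1 + u t x / k) `^ (2 - q^-1))))).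
      by apply: ler_wpM2l; [exact: mu0|apply: H2; rewrite ?u0 ?c0].
    rewrite [leRHS](_ : _ = mu x * (c ^+ m.+2 *
        (phi x ^+ m.+2 * (u t x `^ q / k) - cut_error o N q m (w t x) x) -
        phi x ^+ m.+2 * potential q (w t x) * (m.+2%:R * c ^+ m.+1 / T))); last by ring.
    apply: ler_wpM2l; first exact: mu0.
    have p0 := cutoff_ge0 o N x; have p1 := cutoff_le1 o N0 x.
    set P := w t x `^ _; have P1 : w t x <= P.
      apply: le1r_powR; first exact: w1.
      by have [_ _] := exponent_bounds q1; lra.
    have P0 : 0 <= P by exact: powR_ge0.
    have E1 : c ^+ m.+2 * cut_error o N q m (w t x) x <=
       edge_cst q m / T * ((c * phi x) ^+ m * P).
      rewrite /cut_error mulrCA; apply: ler_wpM2l.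
        by rewrite divr_ge0 ?edge_cst_ge0// ltW.
      have -> : c ^+ m.+2 * ((N < graph_dist o x)%N%:R * (phi x ^+ m * P)) =
          c ^+ 2 * (N < graph_dist o x)%N%:R * ((c * phi x) ^+ m * P).
        rewrite (exprMn _ c) -(addn2 m) exprD; set i := (_ : nat)%:R; ring.
      apply: ler_piMl; first by nonneg.
      by case: ltnP => _; rewrite ?mulr1 ?mulr0 ?exprn_ile1.
    have E2 : phi x ^+ m.+2 * potential q (w t x) * (m.+2%:R * c ^+ m.+1 * T^-1) <=
      m.+2%:R * (1 + q) / T * ((c * phi x) ^+ m * P).
      have -> : m.+2%:R * (1 + q) / T * ((c * phi x) ^+ m * P) =
        (m.+2%:R / T * (c * phi x) ^+ m) * ((1 + q) * P) by ring.
      have -> : phi x ^+ m.+2 * potential q (w t x) * (m.+2%:R * c ^+ m.+1 * T^-1) =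
        (m.+2%:R / T * (c * phi x) ^+ m) * (phi x ^+ 2 * c * potential q (w t x)).
        by rewrite (exprMn _ c) (exprS c) (exprS (phi x)) (exprS (phi x)); ring.
      apply: ler_wpM2l; first by nonneg.
      have w1' := w1 x t_gt0.
      have := potential_le q1 w1'; have := @potential_ge0 R q q1 (w t x) (le_trans ler01 w1').
      have : 0 <= phi x ^+ 2 * c <= 1.
        by rewrite mulr_ge0 ?exprn_ge0// mulr_ile1 ?exprn_ge0 ?exprn_ile1.
      move=> /andP[f0 f1] g0 g1; apply: (@le_trans _ _ (potential q (w t x))).
        by rewrite ler_piMl.
      have q0 : 0 <= 1 + q by have [] := exponent_bounds q1; lra.
      by apply: le_trans g1 _; rewrite ler_wpM2l.
    have -> : (c * phi x) ^+ m.+2 = c ^+ m.+2 * phi x ^+ m.+2 by exact: exprMn.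
    have -> : time_error / T = edge_cst q m / T + m.+2%:R * (1 + q) / T.
      by rewrite -!mulrDl.
    move: E1 E2.
    move: (edge_cst q m / T) (m.+2%:R * (1 + q) / T) => a1 a2.
    move: ((c * phi x) ^+ m * P) (cut_error _ _ _ _ _ _) => X e.
    move: (phi x ^+ m.+2 * potential q (w t x) * _) => f.
    move: (c ^+ m.+2) (phi x ^+ m.+2) (_ / k) => a3 a4 a5 E1 E2.
    rewrite -subr_ge0 [leRHS](_ : _ = (a1 * X - a3 * e) + (a2 * X - f)); last by ring.
    by rewrite addr_ge0 ?subr_ge0.
have m_ge0 : 0 <= mass t0.
  apply: sumr_ge0 => x _; apply: mulr_ge0; first exact: mu0.
  apply: mulr_ge0; first exact/exprn_ge0/cutoff_ge0.
  exact/(potential_ge0 q1)/(le_trans ler01)/w1.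
have S1 : A al1 t0 = - b * t0 * set_measure (graph_ball o (2 * N)%:R).
  rewrite set_measure_ball mulr_sumr; apply: eq_bigr => x _; rewrite U0; ring.
have S2 : A al1 (t0 + T) + A al2 (t0 + 2 * T) - A al2 (t0 + T) =
  \sum_(x <- B) mu x * (al1 x * U x (t0 + T) + al2 x * (U x (t0 + 2 * T) - U x (t0 + T)))
   - b * (t0 + 2 * T) * set_measure (graph_ball o (2 * N)%:R).
  rewrite set_measure_ball mulr_sumr -sumrB -big_split -sumrB/=.
  by apply: eq_bigr => x _; ring.
lra.
Qed.

End energy.

(** * Comparison of the scales N and 2N *)

Section scales.
Variables (R : realType) (G : weighted_graph R) (o : G) (q : R) (u : R -> G -> R).
Variables (t0 : R) (U : G -> R -> R).
Hypotheses (q1 : 1 < q) (hu : nonneg_supersolution q u) (t00 : 0 < t0).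
Hypothesis U0 : forall x, U x t0 = 0.
Hypothesis dU : forall x (t : R), t0 <= t -> is_derive t 1 (U x) (u t x `^ q).

Local Notation mu := vertex_measure.
Local Notation V n := (set_measure (graph_ball o n%:R)).

(** The integral of [u ^ q] over a parabolic cylinder, once [U x] is the
    antiderivative of [u ^ q] at [x] that vanishes at time [t0]. *)
Definition ball_source N : R := \sum_(x <- ball_seq o N) mu x * U x (t0 + N%:R ^+ 2).

Lemma source_ndecr x s t : t0 <= s -> s <= t -> U x s <= U x t.
Proof.
move=> ts st; apply: (@nondecreasing_of_derive R (U x) (fun t => u t x `^ q)) => //.
  by move=> r /andP[sr _]; apply: dU; exact: le_trans sr.
by move=> r _; exact: powR_ge0.
Qed.

Lemma source_ge0 x t : t0 <= t -> 0 <= U x t.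
Proof. by move=> tt; rewrite -(U0 x); exact: source_ndecr. Qed.

Let muge0 (x : G) : 0 <= mu x.
Proof. exact/ltW/vertex_measure_gt0. Qed.

Lemma ball_source_ge0 N : 0 <= ball_source N.
Proof.
apply: sumr_ge0 => x _; apply: mulr_ge0; first exact: muge0.
by apply: source_ge0; rewrite lerDl exprn_ge0.
Qed.

Lemma ball_source_ndecr N M : (N <= M)%N -> ball_source N <= ball_source M.
Proof.
move=> NM; rewrite /ball_source (sum_ball_seq _ _ NM); apply: ler_sum => x _.
have NM2 : N%:R ^+ 2 <= M%:R ^+ 2 :> R by rewrite lerXn2r ?nnegrE// ler_nat.
have N2 : 0 <= N%:R ^+ 2 :> R by rewrite exprn_ge0.
case: ifP => _.
  apply: ler_wpM2l; first exact: muge0.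
  by apply: source_ndecr; lra.
by apply: mulr_ge0; [exact: muge0|apply: source_ge0; lra].
Qed.

Let q0 : 0 < q. Proof. by case: (exponent_bounds q1). Qed.

Lemma time_error_gt0 m : 0 < time_error q m.
Proof.
by rewrite ltr_wpDl ?edge_cst_ge0// mulr_gt0// addr_gt0.
Qed.

(** The exponent [2 - q^-1] is at most [q] because
    [q - (2 - q^-1) = (q - 1) ^ 2 / q]. *)
Lemma error_le (m N : nat) (k z a : R) : (0 < N)%N -> 0 < k -> 0 <= z -> 0 <= a <= 1 ->
  time_error q m / N%:R ^+ 2 * (a ^+ m * (1 + z / k) `^ (2 - q^-1)) <=
  time_error q m * 2 `^ q / N%:R ^+ 2 * (1 + z `^ q / k `^ q).
Proof.
move=> N0 k0 z0 /andP[a0 a1].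
have NR0 : 0 < N%:R ^+ 2 :> R by rewrite exprn_gt0// ltr0n.
have [_ iq0 iq1] := exponent_bounds q1.
have E0 := time_error_gt0 m.
have zk0 : 0 <= z / k by rewrite divr_ge0// ltW.
have w1 : 1 <= 1 + z / k by lra.
have -> : z `^ q / k `^ q = (z / k) `^ q.
  by rewrite powRM ?invr_ge0 ?(ltW k0)// -[in RHS](powR_inv1 (ltW k0)) -powRrM mulN1r powRN.
have -> : time_error q m * 2 `^ q / N%:R ^+ 2 * (1 + (z / k) `^ q) =
   time_error q m / N%:R ^+ 2 * (2 `^ q * (1 + (z / k) `^ q)) by ring.
apply: ler_wpM2l; first by nonneg.
apply: le_trans (powR_1D_le q1 zk0).
apply: (@le_trans _ _ (1 * (1 + z / k) `^ q)); last by rewrite mul1r.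
apply: ler_pM; rewrite ?exprn_ge0 ?powR_ge0 ?exprn_ile1//.
apply: ler_powR => //.
have : (q - 1) ^+ 2 / q >= 0 by rewrite divr_ge0 ?sqr_ge0 ?ltW.
have -> : (q - 1) ^+ 2 / q = q - (2 - q^-1) by field; rewrite gt_eqF.
by rewrite subr_ge0.
Qed.

(** The error is only present outside the ball of radius [N] on the first time
    interval and everywhere in the larger ball on the second one. This region
    is disjoint from the cylinder of scale [N], hence the difference on the
    right. *)
Lemma ball_source_growth : exists2 A : R, 0 < A & forall (N : nat) (k : R),
  (0 < N)%N -> 0 < k ->
  ball_source N / k <= 2 * A * V (2 * N)%N +
     A / (N%:R ^+ 2 * k `^ q) * (ball_source (2 * N) - ball_source N).
Proof.
pose E := time_error q 1; exists (E * 2 `^ q).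
  by rewrite mulr_gt0 ?time_error_gt0// powR_gt0.
move=> N k N0 k0; set A := E * _.
pose T : R := N%:R ^+ 2.
have T0 : 0 < T by rewrite exprn_gt0// ltr0n.
have A0 : 0 < A by rewrite mulr_gt0 ?time_error_gt0// powR_gt0.
have kq0 : 0 < k `^ q by rewrite powR_gt0.
pose b := A / T; pose g := b / k `^ q.
have g0 : 0 <= g by rewrite /g /b; nonneg.
pose al1 x : R := if (graph_dist o x <= N)%N then k^-1 else - g.
have m0 : (0 < 1)%N by [].
have err z a : 0 <= z -> 0 <= a <= 1 ->
    E / T * (a ^+ 1 * (1 + z / k) `^ (2 - q^-1)) <= b + g * z `^ q.
  move=> z0 a01; apply: (le_trans (error_le 1 N0 k0 z0 a01)).
  by rewrite -/E -/A -/T -/b /g mulrDr mulr1 lerD2l mulrA mulrAC.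
have up : \sum_(x <- ball_seq o (2 * N)) mu x * (al1 x * U x (t0 + T) +
    - g * (U x (t0 + 2 * T) - U x (t0 + T))) <= 2 * T * b * V (2 * N)%N.
  apply: (energy_balance (al2 := fun=> - g) q1 hu m0 N0 k0 t00 U0 dU).
  - move=> x z xN z0; have p0 := cutoff_ge0 o N x; have p1 := cutoff_le1 o N0 x.
    have S0 : 0 <= cutoff o N x ^+ 3 * (z `^ q / k) by nonneg.
    rewrite /al1; case: leqP => xN'.
      rewrite /cut_error ltnNge xN'/= mul0r mulr0 subr0 cutoff_eq1//; last exact: leqW.
      rewrite expr1n mul1r mulrC; have : 0 <= b by rewrite /b; nonneg.
      by lra.
    have p01 : 0 <= cutoff o N x <= 1 by rewrite p0.
    have := err z _ z0 p01.
    have : cut_error o N q 1 (1 + z / k) x <=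
        E / T * (cutoff o N x ^+ 1 * (1 + z / k) `^ (2 - q^-1)).
      rewrite /cut_error xN' mul1r; apply: ler_wpM2r; first by nonneg.
      apply: ler_wpM2r; first by rewrite invr_ge0 ltW.
      by rewrite /E /time_error lerDl; nonneg.
    lra.
  - move=> x z c xN z0 /andP[c0 c1].
    have p0 := cutoff_ge0 o N x; have p1 := cutoff_le1 o N0 x.
    have S0 : 0 <= (c * cutoff o N x) ^+ 3 * (z `^ q / k) by nonneg.
    have p01 : 0 <= c * cutoff o N x <= 1 by rewrite mulr_ge0// mulr_ile1.
    have := err z _ z0 p01; rewrite -/E -/T; lra.
have TN : 2 * T <= (2 * N)%:R ^+ 2 :> R.
  by rewrite natrM exprMn -/T; lra.
have low : ball_source N * (k^-1 + g) - g * ball_source (2 * N) <=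
  \sum_(x <- ball_seq o (2 * N)) mu x * (al1 x * U x (t0 + T) +
     - g * (U x (t0 + 2 * T) - U x (t0 + T))).
  have NN : (N <= 2 * N)%N by rewrite leq_pmull.
  rewrite /ball_source (sum_ball_seq _ _ NN) mulr_suml mulr_sumr -sumrB; apply: ler_sum => x _.
  have mono : U x (t0 + 2 * N%:R ^+ 2) <= U x (t0 + (2 * N)%:R ^+ 2).
    by apply: source_ndecr; rewrite -/T; lra.
  rewrite /al1 -/T; rewrite -/T in mono.
  have M : mu x * (g * U x (t0 + 2 * T)) <= mu x * (g * U x (t0 + (2 * N)%:R ^+ 2)).
    by do 2 (apply: ler_wpM2l => //).
  case: ifP => _; lra.
have := le_trans low up.
rewrite (_ : 2 * T * b = 2 * A); last by rewrite /b; field; rewrite gt_eqF.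
rewrite (_ : A / (T * k `^ q) = g); first by lra.
by rewrite /g /b invfM mulrA.
Qed.

(** The level satisfies [k ^ (q - 1) = L / N ^ 2], for which the source
    [u ^ q / k] has the same factor [N ^ -2] as the error, with a constant
    [L] that is large enough for half of the source to absorb the error. *)
Lemma ball_source_upper : exists2 K : R, 0 < K & forall N : nat, (0 < N)%N ->
  N%:R ^+ 2 * V (2 * N)%N `^ (1 - q) * ball_source N `^ (q - 1) <= K.
Proof.
have [_ iq0 iq1] := exponent_bounds q1.
pose p := 2 - q^-1; have p0 : 0 < p by rewrite /p; lra.
have pq : p < q.
  rewrite -subr_gt0 (_ : q - p = (q - 1) ^+ 2 / q); last first.
    by rewrite /p; field; rewrite gt_eqF.
  by rewrite divr_gt0 ?exprn_gt0 ?subr_gt0.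
pose r := p / (q - p); have r0 : 0 <= r.
  by apply: divr_ge0; [exact: ltW|rewrite subr_ge0; exact: ltW].
pose m := (Num.bound (2 * r)).+1.
have hm : 2 * r <= m%:R.
  apply: ltW; apply: (lt_trans (archi_boundP _)); first by rewrite mulr_ge0.
  by rewrite ltr_nat.
pose E := time_error q m; have E0 : 0 < E by exact: time_error_gt0.
pose b0 := 2 `^ q + E * E `^ r; pose L : R := 2 * 2 `^ q.
have b00 : 0 < b0 by rewrite ltr_pwDl ?powR_gt0// mulr_ge0 ?powR_ge0// ltW.
have L0 : 0 < L by rewrite mulr_gt0 ?powR_gt0.
exists ((4 * b0) `^ (q - 1) * L); first by rewrite mulr_gt0 ?powR_gt0// mulr_gt0.
move=> N N0; pose T : R := N%:R ^+ 2.
have T0 : 0 < T by rewrite exprn_gt0// ltr0n.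
have q10 : 0 < q - 1 by rewrite subr_gt0.
pose k := (L / T) `^ (q - 1)^-1.
have k0 : 0 < k by apply: powR_gt0; exact: divr_gt0.
have kq1 : k `^ (q - 1) = L / T.
  by rewrite -powRrM mulVf ?gt_eqF// powRr1// divr_ge0 ?ltW.
have kq : k `^ q = L / T * k.
  by rewrite -kq1 mulrC mulr_powRB1// ltW.
pose al1 x : R := if (graph_dist o x <= N)%N then (2 * k)^-1 else 0.
have V0 := ball_measure_gt0 o (2 * N).
have err z a : 0 <= z -> 0 <= a <= 1 ->
    E / T * (a ^+ m * (1 + z / k) `^ p) <= a ^+ m.+2 * (z `^ q / (2 * k)) + b0 / T.
  move=> z0 /andP[a0 a1].
  have zk0 : 0 <= z / k by rewrite divr_ge0// ltW.
  have := absorb_error q1 p0 pq E0 a0 a1 zk0 hm.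
  have -> : (z / k) `^ q = z `^ q / k `^ q.
    by rewrite powRM ?invr_ge0 ?(ltW k0)// -[in LHS](powR_inv1 (ltW k0)) -powRrM mulN1r powRN.
  have iT0 : 0 < T^-1 by rewrite invr_gt0.
  rewrite -(ler_pM2r iT0) => h.
  rewrite mulrAC; apply: (le_trans h); rewrite -/b0 mulrDl lerD2r kq /L.
  rewrite le_eqVlt; apply/orP; left; apply/eqP; field.
  by rewrite !gt_eqF// powR_gt0.
have up : \sum_(x <- ball_seq o (2 * N)) mu x * (al1 x * U x (t0 + T) +
    0 * (U x (t0 + 2 * T) - U x (t0 + T))) <= 2 * T * (b0 / T) * V (2 * N)%N.
  apply: (energy_balance (al2 := fun=> 0) q1 hu (m := m) isT N0 k0 t00 U0 dU).
  - move=> x z xN z0; have c0 := cutoff_ge0 o N x; have c1 := cutoff_le1 o N0 x.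
    rewrite /al1; case: leqP => xN'.
      rewrite /cut_error ltnNge xN'/= mul0r mulr0 subr0 cutoff_eq1//; last exact: leqW.
      rewrite expr1n mul1r mulrC; have : 0 <= b0 / T by nonneg.
      have : z `^ q / (2 * k) <= z `^ q / k.
        apply: ler_wpM2l; first exact: powR_ge0.
        by rewrite lef_pV2 ?posrE ?mulr_gt0//; lra.
      lra.
    have c01 : 0 <= cutoff o N x <= 1 by rewrite c0.
    have := err z _ z0 c01.
    have : cut_error o N q m (1 + z / k) x <=
        E / T * (cutoff o N x ^+ m * (1 + z / k) `^ p).
      rewrite /cut_error xN' mul1r; apply: ler_wpM2r; first by nonneg.
      apply: ler_wpM2r; first by rewrite invr_ge0 ltW.
      by rewrite /E /time_error lerDl; nonneg.
    have : cutoff o N x ^+ m.+2 * (z `^ q / (2 * k)) <= cutoff o N x ^+ m.+2 * (z `^ q / k).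
      apply: ler_wpM2l; first exact: exprn_ge0.
      apply: ler_wpM2l; first exact: powR_ge0.
      by rewrite lef_pV2 ?posrE ?mulr_gt0//; lra.
    lra.
  - move=> x z c xN z0 /andP[c0 c1].
    have p0' := cutoff_ge0 o N x; have p1 := cutoff_le1 o N0 x.
    have p01 : 0 <= c * cutoff o N x <= 1 by rewrite mulr_ge0// mulr_ile1.
    have := err z _ z0 p01; rewrite -/E -/T.
    have : (c * cutoff o N x) ^+ m.+2 * (z `^ q / (2 * k)) <=
           (c * cutoff o N x) ^+ m.+2 * (z `^ q / k).
      apply: ler_wpM2l; first by apply: exprn_ge0; case/andP: p01.
      apply: ler_wpM2l; first exact: powR_ge0.
      by rewrite lef_pV2 ?posrE ?mulr_gt0//; lra.
    lra.
have low : ball_source N / (2 * k) =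
  \sum_(x <- ball_seq o (2 * N)) mu x * (al1 x * U x (t0 + T) +
     0 * (U x (t0 + 2 * T) - U x (t0 + T))).
  have NN : (N <= 2 * N)%N by rewrite leq_pmull.
  rewrite /ball_source (sum_ball_seq _ _ NN) mulr_suml; apply: eq_bigr => x _.
  by rewrite mul0r addr0 /al1 -/T; case: ifP => _; ring.
have bound : ball_source N <= 4 * b0 * V (2 * N)%N * k.
  move: up; rewrite -low ler_pdivrMr ?mulr_gt0// => /le_trans; apply.
  rewrite le_eqVlt; apply/orP; left; apply/eqP; field; exact: lt0r_neq0.
have c0 := ball_source_ge0 N.
have -> : 1 - q = - (q - 1) by ring.
rewrite powRN -/T.
apply: (@le_trans _ _ (T / V (2 * N)%N `^ (q - 1) * (4 * b0 * V (2 * N)%N * k) `^ (q - 1))).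
  apply: ler_wpM2l; first by rewrite divr_ge0 ?powR_ge0// ltW.
  by apply: ge0_ler_powR => //; rewrite ?nnegrE ?(ltW q10)//; nonneg.
rewrite !powRM; [|by nonneg..]; rewrite kq1.
rewrite le_eqVlt; apply/orP; left; apply/eqP; field.
by rewrite !gt_eqF// powR_gt0.
Qed.

(** If the source jumps by more than its own size, only a part [e <= D] of the
    jump is used; the a priori bound guarantees that this part is still of the
    order that the growth inequality gives. *)
Lemma ball_source_step : exists2 C : R, 0 < C & forall N : nat, (0 < N)%N -> 0 < ball_source N ->
  N%:R ^+ 2 * V (2 * N)%N `^ (1 - q) <=
  C * (ball_source N `^ (1 - q) - ball_source (2 * N) `^ (1 - q)).
Proof.
have [A A0 growth] := ball_source_growth; have [K K0 upper] := ball_source_upper.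
have q10 : 0 < q - 1 by rewrite subr_gt0.
pose c := 2 / (4 * A) `^ q.
have c0 : 0 < c by rewrite divr_gt0 ?powR_gt0// mulr_gt0.
pose d := Num.min c K^-1.
have d0 : 0 < d by rewrite lt_min c0 invr_gt0.
have dc : d <= c by rewrite ge_min lexx.
have dK : d <= K^-1 by rewrite ge_min lexx orbT.
exists ((q - 1) * 2 `^ (- q) * d)^-1.
  by rewrite invr_gt0 !mulr_gt0 ?powR_gt0.
move=> N N0 D0; set D := ball_source N in D0 *; set D' := ball_source (2 * N).
set W := V (2 * N)%N; have W0 : 0 < W by exact: ball_measure_gt0.
pose T : R := N%:R ^+ 2; have T0 : 0 < T by rewrite exprn_gt0// ltr0n.
rewrite -/T; set b := T * W `^ (1 - q).
have b0 : 0 < b by rewrite mulr_gt0 ?powR_gt0.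
(* The level makes [ball_source N / k] twice the volume term of the growth
   inequality, so half of it is left for the increment. *)
have grow : c * b * D `^ q <= D' - D.
  have k0 : 0 < D / (4 * A * W) by rewrite divr_gt0// !mulr_gt0.
  have := growth N _ N0 k0; rewrite -/D -/D' -/W -/T.
  have -> : D / (D / (4 * A * W)) = 4 * A * W.
    by field; rewrite !gt_eqF.
  rewrite powRM ?(ltW D0) ?invr_ge0 ?mulr_ge0 ?(ltW A0) ?(ltW W0)//.
  have -> : (4 * A * W)^-1 `^ q = ((4 * A) `^ q * W `^ q)^-1.
    rewrite -powRM ?mulr_ge0 ?(ltW A0) ?(ltW W0)//.
    by rewrite -powR_inv1 ?mulr_ge0 ?(ltW A0) ?(ltW W0)// -powRrM mulN1r powRN.
  have Wq : W `^ (1 - q) = W / W `^ q.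
    by rewrite powRB ?(gt_eqF W0) ?implybT// powRr1// ltW.
  have := powR_gt0 q D0; have := powR_gt0 q W0; have A4 : 0 < 4 * A by rewrite mulr_gt0.
  have := powR_gt0 q A4; rewrite /b /c Wq.
  move: (D `^ q) (W `^ q) ((4 * A) `^ q) => Dq Wq' Aq Aq0 Wq0 Dq0.
  have -> : A / (T * (Dq * (Aq * Wq')^-1)) * (D' - D) = A * (Aq * Wq' / (T * Dq)) * (D' - D).
    by field; rewrite !gt_eqF.
  move=> h; have {}h : 2 * W <= Aq * Wq' / (T * Dq) * (D' - D).
    by rewrite -(ler_pM2l A0); lra.
  have X0 : 0 < Aq * Wq' / (T * Dq) by rewrite divr_gt0// mulr_gt0.
  move: h; rewrite -ler_pdivrMl// => h; apply: le_trans h.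
  rewrite le_eqVlt; apply/orP; left; apply/eqP; field.
  by rewrite !gt_eqF.
have le_b : b * D `^ (q - 1) <= K by exact: upper.
have Dq : D `^ q = D * D `^ (q - 1) by rewrite mulr_powRB1// ltW.
pose e := d * b * D `^ q.
have e0 : 0 < e by apply: mulr_gt0; [exact: mulr_gt0|exact: powR_gt0].
have eD : e <= D.
  rewrite /e Dq [leLHS](_ : _ = D * (d * (b * D `^ (q - 1)))); last by ring.
  rewrite -[leRHS]mulr1; apply: ler_wpM2l; first exact: ltW.
  apply: (@le_trans _ _ (K^-1 * K)); last by rewrite mulVf// gt_eqF.
  by apply: ler_pM; rewrite ?mulr_ge0 ?powR_ge0 ?(ltW d0) ?(ltW b0).
have DeD' : D + e <= D'.
  have : e <= c * b * D `^ q.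
    apply: ler_wpM2r; first exact: powR_ge0.
    by apply: ler_wpM2r => //; exact: ltW.
  lra.
have De : D <= D + e by lra.
have := powR_tangent (ltW q10) D0 De.
have -> : - (q - 1) - 1 = - q by ring.
have -> : - (q - 1) = 1 - q by ring.
have -> : D + e - D = e by ring.
move=> tan.
have mono : D' `^ (1 - q) <= (D + e) `^ (1 - q).
  by apply: powR_nincr; lra.
have low : (2 * D) `^ (- q) <= (D + e) `^ (- q).
  by apply: powR_nincr; lra.
rewrite -ler_pdivrMl; last by rewrite invr_gt0 !mulr_gt0 ?powR_gt0.
rewrite invrK.
have -> : (q - 1) * 2 `^ (- q) * d * b = (q - 1) * e * (2 * D) `^ (- q).
  rewrite powRM ?(ltW D0)// /e (powRN D).
  by field; rewrite gt_eqF// powR_gt0.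
apply: (@le_trans _ _ ((q - 1) * e * (D + e) `^ (- q))).
  by apply: ler_wpM2l => //; rewrite mulr_ge0 ?ltW.
lra.
Qed.

End scales.

(** * The integral test *)

Section integral_test.
Variables (R : realType) (G : weighted_graph R) (o : G) (q : R).
Local Notation V r := (set_measure (graph_ball o r)).
Local Notation I k := (`[k.+1%:R : R, k.+2%:R[%classic).

Lemma graph_ball_step (n : nat) (r : R) : n%:R <= r < n.+1%:R ->
  graph_ball o r = graph_ball o n%:R.
Proof.
move=> /andP[nr rn]; rewrite graph_ballE; apply/seteqP; split => x; rewrite /graph_ball/=.
  by move=> /le_lt_trans - /(_ _ rn); rewrite ltr_nat.
by move=> xn; apply: le_trans nr; rewrite ler_nat.
Qed.

Lemma unit_intervals_cover : `[1 : R, +oo[%classic = \bigcup_k I k.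
Proof.
apply/seteqP; split => r /=; last first.
  by move=> [k _] /=; rewrite !in_itv/= andbT => /andP[kr _]; apply: le_trans kr; rewrite ler1n.
rewrite in_itv/= andbT => r1.
have r1' : 0 <= r - 1 by lra.
have /andP[kr rk] := truncn_itv r1'.
exists (Num.truncn (r - 1)) => //=; rewrite in_itv/=.
rewrite -(natr1 (Num.truncn _).+1) -(natr1 (Num.truncn _)).
by rewrite -natr1 in rk; apply/andP; split; lra.
Qed.

Lemma unit_intervals_disjoint : trivIset [set: nat] (fun k => I k).
Proof.
apply/trivIsetP => i j _ _; wlog ij : i j / (i < j)%N => [th ne|ne].
  case: (ltngtP i j) => h; [exact: th|rewrite setIC; apply: th => //|by rewrite h eqxx in ne].
  by rewrite eq_sym.
apply/seteqP; split => r //= []; rewrite !in_itv/= => /andP[_ ri] /andP[rj _].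
have := le_lt_trans rj ri; rewrite ltr_nat; lia.
Qed.

Let f (r : R) : \bar R := (r / V r `^ (q - 1))%:E.
Let a (n : nat) : \bar R := (n%:R / V n%:R `^ (q - 1))%:E.

Let a_ge0 n : (0 <= a n)%E.
Proof. by rewrite lee_fin divr_ge0// powR_ge0. Qed.

Let f_step k r : I k r -> f r = (r / V k.+1%:R `^ (q - 1))%:E.
Proof. by move=> /=; rewrite in_itv/= => h; rewrite /f (graph_ball_step h). Qed.

Let measurable_f k : measurable_fun (I k) f.
Proof.
apply: (eq_measurable_fun (fun r : R => (r / V k.+1%:R `^ (q - 1))%:E)).
  by move=> r; rewrite inE => /f_step ->.
by apply/measurable_EFinP; exact: measurable_funM.
Qed.

(** The upper bound uses [r < k + 2 <= 2 * (k + 1)]. *)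
Lemma integral_unit_interval k :
  (a k.+1 <= \int[lebesgue_measure]_(r in I k) f r <= 2%:E * a k.+1)%E.
Proof.
have mI : measurable (I k) by [].
have cst_int (c : \bar R) : (\int[lebesgue_measure]_(r in I k) cst c r)%E = c.
  rewrite integral_cst//=; rewrite lebesgue_measure_itv/= lte_fin ltr_nat ltnSn.
  by rewrite -EFinB -(natr1 k.+1) addrAC subrr add0r mule1.
have W0 := powR_ge0 (V k.+1%:R) (q - 1).
have IkE r : I k r -> k.+1%:R <= r <= k.+2%:R.
  by rewrite /= in_itv/= => /andP[-> /ltW].
have f0 r : I k r -> (0 <= f r)%E.
  move=> rI; have /andP[kr _] := IkE r rI.
  by rewrite (f_step rI) lee_fin divr_ge0// (le_trans _ kr).
apply/andP; split.
  rewrite -[leLHS]cst_int; apply: ge0_le_integral.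
  - by [].
  - by move=> r _; exact: a_ge0.
  - exact: measurable_cst.
  - exact: measurable_f.
  move=> r rI; rewrite /cst; have /andP[kr _] := IkE r rI.
  by rewrite (f_step rI) lee_fin; apply: ler_wpM2r; rewrite ?invr_ge0.
rewrite -[leRHS]cst_int; apply: ge0_le_integral => //=; first exact: measurable_f.
move=> r rI; have /andP[_ rk] := IkE r rI.
rewrite (f_step rI) -EFinM lee_fin mulrA; apply: ler_wpM2r; first by rewrite invr_ge0.
by apply: (le_trans rk); rewrite -natrM ler_nat; lia.
Qed.

Lemma integral_sum_eqy :
  (\int[lebesgue_measure]_(r in `[1%R, +oo[) f r)%E = +oo%E <->
  (\sum_(1 <= n <oo) a n)%E = +oo%E.
Proof.
rewrite unit_intervals_cover ge0_integral_bigcup//; last 3 first.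
- by apply/measurable_fun_bigcup.
- move=> r [k _ rI]; rewrite (f_step rI) lee_fin divr_ge0 ?powR_ge0//.
  by move: rI => /=; rewrite in_itv/= => /andP[kr _]; apply: le_trans kr.
- exact: unit_intervals_disjoint.
rewrite -(nneseries_addn 1 a_ge0).
have low : (\sum_(0 <= k <oo) a (k + 1)%N <=
    \sum_(0 <= k <oo) \int[lebesgue_measure]_(r in I k) f r)%E.
  apply: lee_nneseries => // k _.
  by rewrite addn1; have /andP[] := integral_unit_interval k.
have up : (\sum_(0 <= k <oo) \int[lebesgue_measure]_(r in I k) f r <=
    2%:E * \sum_(0 <= k <oo) a (k + 1)%N)%E.
  rewrite -nneseriesZl//; apply: lee_nneseries => [k _ _|k _].
    by have /andP[+ _] := integral_unit_interval k; exact: le_trans.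
  by rewrite addn1; have /andP[] := integral_unit_interval k.
split => [h|h]; last by apply/eqP; rewrite -leye_eq -h.
have : (0 <= \sum_(0 <= k <oo) a (k + 1)%N)%E by apply: nneseries_ge0.
move: up; rewrite h leye_eq.
by case: (\sum_(0 <= k <oo) a (k + 1)%N)%E.
Qed.

End integral_test.

(** * Vanishing of supersolutions *)

Lemma nneseries_bounded_neqy (R : realType) (f : nat -> R) (M : R) :
  (forall n, 0 <= f n) ->
  (forall n, \sum_(1 <= i < n) f i <= M) ->
  (\sum_(1 <= i <oo) (f i)%:E)%E <> +oo%E.
Proof.
move=> f0 fM; apply/eqP; rewrite lt_eqF//.
apply: (@le_lt_trans _ _ M%:E); last exact: ltry.
apply: lime_le; first by apply: is_cvg_nneseries => n _ _; rewrite lee_fin.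
by apply: nearW => n; rewrite sumEFin lee_fin.
Qed.

(** The block has [2 N] terms, each at most [4 N * a (2 N)]. *)
Lemma dyadic_block (R : realType) (a : nat -> R) (N : nat) :
  (forall n, 0 <= a n) -> (forall n m, (n <= m)%N -> a m <= a n) ->
  \sum_(2 * N <= i < 4 * N) i%:R * a i <= 8 * (N%:R ^+ 2 * a (2 * N)%N).
Proof.
move=> a0 anti.
apply: (@le_trans _ _ (\sum_(2 * N <= i < 4 * N) 4 * N%:R * a (2 * N)%N)).
  rewrite big_nat_cond [leRHS]big_nat_cond; apply: ler_sum => i.
  rewrite andbT => /andP[iN Ni]; apply: ler_pM => //; last exact: anti.
  by rewrite -natrM ler_nat ltnW.
rewrite sumr_const_nat (_ : (4 * N - 2 * N = 2 * N)%N); last by lia.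
rewrite -[leLHS]mulr_natl natrM le_eqVlt; apply/orP; left; apply/eqP; ring.
Qed.

(** Time starts at [t / 2], because nothing is known about [u] at time 0. The
    bounds of [ball_source_step] at the scales [2 ^ k] telescope, so all partial
    sums of the series are bounded. *)
Lemma supersolution_eq0 (R : realType) (q : R) (G : weighted_graph R) (o : G)
    (u : R -> G -> R) (t : R) (x : G) : 1 < q -> nonneg_supersolution q u ->
  (\sum_(1 <= n <oo)
     (n%:R * set_measure (graph_ball o n%:R) `^ (1 - q))%:E)%E = +oo%E ->
  0 < t -> u t x = 0.
Proof.
move=> q1 hu div t_gt0; apply/eqP; apply: contrapT => /negP utx.
pose t0 := t / 2; have t00 : 0 < t0 by rewrite divr_gt0.
have q0 : 0 < q by apply: lt_trans q1.
have [u0 du _ _] := hu.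
have ut : 0 < u t x by rewrite lt_neqAle eq_sym utx u0.
have H y : exists F : R -> R, F t0 = 0 /\
    forall s, t0 <= s -> is_derive s 1 F (u s y `^ q).
  have [s s0|F [F0 dF]] := @antiderivative R (fun s => `|u s y| `^ q) t0 t00.
    apply: (@continuous_comp _ _ _ (u^~ y) (fun z => `|z| `^ q)).
      by apply: differentiable_continuous; apply/derivable1_diffP; exact: du.
    exact: continuous_norm_powR.
  exists F; split => // s t0s; have := dF s t0s.
  by rewrite ger0_norm// u0// (lt_le_trans t00).
have /choice[U HU] := H.
have U0 y : U y t0 = 0 by case: (HU y).
have dU y s : t0 <= s -> is_derive s 1 (U y) (u s y `^ q) by case: (HU y) => _; exact.
have tt0 : t0 < t by rewrite /t0; lra.
have Ux s : t < s -> 0 < U x s.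
  move=> ts; rewrite lt_neqAle eq_sym (source_ge0 U0 dU) ?andbT; last by lra.
  (* Otherwise [U x] would be constant around [t], where its derivative is
     [u t x `^ q > 0]. *)
  apply/eqP => Us0.
  have Ut r : t0 <= r <= s -> U x r = 0.
    move=> /andP[t0r rs]; apply/eqP; rewrite eq_le (source_ge0 U0 dU)// andbT.
    by rewrite -Us0; exact: (source_ndecr dU).
  have near0 : \forall r \near t, cst 0 r = U x r.
    near=> r; apply/esym/Ut; apply/andP; split; apply/ltW; near: r.
      exact: lt_nbhsr.
    exact: lt_nbhsl.
  have d1 := near_eq_is_derive near0 (is_derive_cst (0 : R) t 1).
  have [_ e1] := d1; have [_ e2] := dU x t (ltW tt0).
  by have := powR_gt0 q ut; rewrite -e2 e1 ltxx.
pose D k := ball_source o t0 U (2 ^ k).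
have [k0 Dk0] : exists k0, 0 < D k0.
  pose k0 := maxn (graph_dist o x) (Num.bound t).
  exists k0.
  have k0lt : (k0 < 2 ^ k0)%N by exact: ltn_expl.
  have xin : x \in ball_seq o (2 ^ k0).
    by rewrite mem_ball_seq; apply: leq_trans (ltnW k0lt); exact: leq_maxl.
  have big : t < t0 + (2 ^ k0)%:R ^+ 2.
    have tb : t < (2 ^ k0)%:R.
      apply: (lt_le_trans (archi_boundP (ltW t_gt0))); rewrite ler_nat.
      by apply: leq_trans (ltnW k0lt); exact: leq_maxr.
    have b1 : 1 <= (2 ^ k0)%:R :> R by rewrite ler1n expn_gt0.
    rewrite -[t]add0r; apply: ltrD => //; apply: (lt_le_trans tb).
    by rewrite expr2 ler_peMr// (le_trans ler01).
  rewrite /D /ball_source (bigD1_seq x xin (ball_seq_uniq _ _))/=.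
  apply: ltr_pwDl; first by rewrite mulr_gt0 ?vertex_measure_gt0// Ux.
  apply: sumr_ge0 => y _; rewrite mulr_ge0 ?(ltW (vertex_measure_gt0 _))//.
  by apply: (source_ge0 U0 dU); rewrite lerDl exprn_ge0.
have Dmono i j : (i <= j)%N -> D i <= D j.
  by move=> ij; apply: (ball_source_ndecr o U0 dU); rewrite leq_exp2l.
have Dpos k : (k0 <= k)%N -> 0 < D k.
  by move=> kk; apply: (lt_le_trans Dk0); exact: Dmono.
have [C C0 step] := ball_source_step o q1 hu t00 U0 dU.
pose a n := set_measure (graph_ball o n%:R) `^ (1 - q).
have a0 n : 0 <= a n by exact: powR_ge0.
have anti n m : (n <= m)%N -> a m <= a n.
  move=> nm; apply: powR_nincr; last exact: ball_measure_le.
  - by rewrite subr_le0 ltW.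
  - exact: ball_measure_gt0.
have tail j : \sum_(2 * 2 ^ k0 <= i < 2 * 2 ^ (k0 + j)) i%:R * a i <=
    8 * C * (D k0 `^ (1 - q) - D (k0 + j)%N `^ (1 - q)).
  elim: j => [|j IH]; first by rewrite addn0 big_geq// subrr mulr0.
  have e4 : (2 * 2 ^ (k0 + j.+1) = 4 * 2 ^ (k0 + j))%N by rewrite addnS expnS mulnA.
  rewrite e4 (@big_cat_nat _ _ _ (2 * 2 ^ (k0 + j)))/=; last 2 first.
  - by rewrite leq_mul2l leq_exp2l// leq_addr.
  - by rewrite leq_mul2r orbT.
  have N0 : (0 < 2 ^ (k0 + j))%N by rewrite expn_gt0.
  have := step _ N0 (Dpos _ (leq_addr _ _)).
  have -> : ball_source o t0 U (2 * 2 ^ (k0 + j)) = D (k0 + j.+1)%N by rewrite /D addnS expnS.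
  have := dyadic_block (2 ^ (k0 + j)) a0 anti.
  rewrite -/(D (k0 + j)%N) /a.
  move: IH; rewrite /a; lra.
apply: (nneseries_bounded_neqy (f := fun n => n%:R * a n)
   (M := \sum_(1 <= i < 2 * 2 ^ k0) i%:R * a i + 8 * C * D k0 `^ (1 - q))) div.
  by move=> n; rewrite mulr_ge0.
move=> n; have nb : (n <= 2 * 2 ^ (k0 + n))%N.
  apply: (@leq_trans (k0 + n)); first exact: leq_addl.
  by apply: leq_trans (ltnW (ltn_expl _ (isT : 1 < 2)%N)) _; rewrite leq_pmull.
have b1 : (1 <= 2 * 2 ^ k0)%N by rewrite muln_gt0 expn_gt0.
have kb : (2 * 2 ^ k0 <= 2 * 2 ^ (k0 + n))%N by rewrite leq_mul2l leq_exp2l// leq_addr.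
have S0 : \sum_(1 <= i < n) i%:R * a i <= \sum_(1 <= i < 2 * 2 ^ (k0 + n)) i%:R * a i.
  have [n0|n0] := leqP 1 n.
    rewrite [leRHS](@big_cat_nat _ _ _ n)//= lerDl sumr_ge0// => i _.
    by rewrite mulr_ge0.
  by rewrite big_geq ?(ltnW n0)// sumr_ge0// => i _; rewrite mulr_ge0.
apply: (le_trans S0); rewrite (@big_cat_nat _ _ _ (2 * 2 ^ k0))//= lerD2l.
apply: (le_trans (tail n)); rewrite ler_pM2l ?mulr_gt0// gerBl.
exact: powR_ge0.
Unshelve. all: by end_near. Qed.

Theorem corollary1p6 (R : realType) (q : R) (G : weighted_graph R) (o : G)
    (hq : 1 < q) :
  ((\int[lebesgue_measure]_(r in `[1%R, +oo[)
       (r / set_measure (graph_ball o r) `^ (q - 1))%:E)%E = +oo%E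
   <->
   (\sum_(1 <= n <oo)
       (n%:R / set_measure (graph_ball o n%:R) `^ (q - 1))%:E)%E = +oo%E)
  /\
  ((\sum_(1 <= n <oo)
       (n%:R * set_measure (graph_ball o n%:R) `^ (1 - q))%:E)%E = +oo%E ->
   forall u : R -> G -> R, nonneg_supersolution q u ->
     forall (t : R) (x : G), 0 < t -> u t x = 0).
Proof.
split; first exact: integral_sum_eqy.
by move=> div u hu t x; exact: supersolution_eq0 div.
Qed.
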